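(* Let $M$ be a connected matroid with cycle system $\mathcal{C}=\{C_1,\dots,C_g\}$, and suppose that there exist $e_1,\dots,e_k\in\mathcal{C}_{[g]}$ with $k\le g$ and $e_i\in C_i$ for each $i\in[k]$ (in particular, the $e_i$ are all distinct), such that no $e_i$ is parallel in $M$ to any other element. Let $D_1,\dots,D_n$ ($n\ge1$) be circuits of size $>2$ of $M\setminus\{e_1,\dots,e_k\}$, and let $D:=D_1\cup\dots\cup D_n$. Then the unique union $$\ast\{\widetilde{C_1},\dots,\widetilde{C_k},\widetilde{D}\}$$ is dependent in $\widetilde{M}$.
   Context: Matroids are on finite ground sets; $E(M)$ is the ground set and $r(M)$ the rank. A set is dependent if it is not independent. A cycle of $M$ is a subset of $E(M)$ that can be expressed as a union of circuits. The corank of $M$ is $g=|E(M)|-r(M)$. For subsets $A_1,\dots,A_k$ of a set $E$ and $S\subseteq[k]=\{1,\dots,k\}$, the unique union $\mathcal{A}_S=\ast\{A_i: i\in S\}$ is the set of elements of $E$ that belong to exactly one of the sets $A_i$, $i\in S$ (for a listed family $\ast\{A_1,\dots,A_k\}$, elements belonging to exactly one listed set). A cycle system on a matroid $M$ of corank $g$ is a collection $\mathcal{C}=\{C_1,\dots,C_g\}$ of $g$ cycles of $M$ such that for every nonempty $S\subseteq[g]$ the unique union $\mathcal{C}_S=\ast\{C_i:i\in S\}$ is dependent in $M$. Distinct elements $a,b$ are parallel if $\{a,b\}$ is a circuit; parallel classes are the classes of the equivalence relation ''equal or parallel''. The simplification $\widetilde{M}$ is obtained from $M$ by deleting all loops and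 all but one chosen representative of each parallel class (it is well-defined up to isomorphism). For a fixed choice of simplification and $S\subseteq E(M)$, $\widetilde{S}$ denotes the image of $S$ in $\widetilde{M}$ under the map sending each element to the chosen representative of its parallel class. *)

(* Defs.v *)
From mathcomp Require Import all_boot.

Set Implicit Arguments.
Unset Strict Implicit.
Unset Printing Implicit Defensive.

(* The ground set is a subset of the carrier type, so that a matroid and its
   restrictions live on the same type. *)
Record matroid (T : finType) := Matroid {
  ground : {set T};
  indep : {set T} -> bool;
  indep_ground : forall I : {set T}, indep I -> I \subset ground;
  indep_set0 : indep set0;
  indep_subset : forall I J : {set T}, J \subset I -> indep I -> indep J;
  indep_augment : forall I J : {set T}, indep I -> indep J -> #|I| < #|J| ->
    exists2 x, x \in J :\: I & indep (x |: I)
}.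

Section MatroidDefs.
Variable T : finType.
Implicit Types (M : matroid T) (X S : {set T}) (x y : T).

Section Restriction.
Variables (M : matroid T) (X : {set T}).

Definition restrict_indep (I : {set T}) := indep M I && (I \subset X).

Fact restrict_ground (I : {set T}) : restrict_indep I -> I \subset ground M :&: X.
Proof. by case/andP=> /indep_ground IE IX; rewrite subsetI IE. Qed.

Fact restrict_set0 : restrict_indep set0.
Proof. by rewrite /restrict_indep indep_set0 sub0set. Qed.

Fact restrict_subset (I J : {set T}) :
  J \subset I -> restrict_indep I -> restrict_indep J.
Proof.
move=> JI /andP[indI IX]; apply/andP; split; first exact: indep_subset indI.
exact: subset_trans IX.
Qed.

Fact restrict_augment (I J : {set T}) :
  restrict_indep I -> restrict_indep J -> #|I| < #|J| ->
  exists2 x, x \in J :\: I & restrict_indep (x |: I).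
Proof.
move=> /andP[indI IX] /andP[indJ JX] ltIJ.
have [x xJI indxI] := indep_augment indI indJ ltIJ.
exists x => //; rewrite /restrict_indep indxI subUset sub1set IX andbT.
by move: xJI; rewrite inE => /andP[_ /(subsetP JX)].
Qed.

Definition restriction : matroid T :=
  Matroid restrict_ground restrict_set0 restrict_subset restrict_augment.

End Restriction.

Definition deletion M X : matroid T := restriction M (ground M :\: X).

Definition dependent M X := (X \subset ground M) && ~~ indep M X.

Definition circuit M X := minset (dependent M) X.

Definition cycle M X :=
  [exists P : {set {set T}}, [forall A in P, circuit M A] && (X == cover P)].

Definition rank M := \max_(I : {set T} | indep M I) #|I|.

Definition corank M := #|ground M| - rank M.

Definition connected M := forall x y,
  x \in ground M -> y \in ground M -> x != y ->
  exists2 A, circuit M A & (x \in A) && (y \in A).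

Definition unique_union (I : finType) (A : I -> {set T}) (S : {set I}) :
  {set T} := [set x | #|[set i in S | x \in A i]| == 1].

Definition cycle_system M (C : 'I_(corank M) -> {set T}) :=
  (forall i, cycle M (C i)) /\
  (forall S : {set 'I_(corank M)}, S != set0 ->
     dependent M (unique_union C S)).

Definition parallel M x y := (x != y) && circuit M [set x; y].

Definition nonloops M := [set x in ground M | ~~ circuit M [set x]].

Definition parallel_classes M : {set {set T}} :=
  equivalence_partition (fun x y => (x == y) || parallel M x y) (nonloops M).

Lemma nonloopE M x : (x \in nonloops M) = indep M [set x].
Proof.
rewrite inE; apply/andP/idP => [[xE]|indx].
  apply: contraNT => ndx; apply/minsetP; split.
    by rewrite /dependent sub1set xE.
  move=> B /andP[_ ndB]; rewrite subset1 => /orP[/eqP //|/eqP B0].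
  by rewrite B0 indep_set0 in ndB.
split; first by rewrite -sub1set indep_ground.
by apply/negP => /minsetp /andP[_]; rewrite indx.
Qed.

Lemma nonloop_parallelE M x y : x \in nonloops M -> y \in nonloops M ->
  (x == y) || parallel M x y = (x == y) || ~~ indep M [set x; y].
Proof.
move=> xN yN; rewrite /parallel; case: eqVneq => //= xy.
apply/idP/idP => [/minsetp /andP[] //|nd]; apply/minsetP; split.
  rewrite /dependent nd subUset !sub1set andbT.
  by move: xN yN; rewrite !inE => /andP[-> _] /andP[-> _].
move=> B /andP[_ ndB] sB; apply/eqP; rewrite eqEsubset sB /=.
rewrite subUset !sub1set; apply/andP; split; apply: contraR ndB => nB.
  move: yN; rewrite nonloopE; apply: indep_subset.
  apply/subsetP => z zB; move/subsetP/(_ z zB): sB; rewrite !inE.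
  by case/orP => // /eqP zx; rewrite zx in zB; rewrite zB in nB.
move: xN; rewrite nonloopE; apply: indep_subset.
apply/subsetP => z zB; move/subsetP/(_ z zB): sB; rewrite !inE.
by case/orP => // /eqP zy; rewrite zy in zB; rewrite zB in nB.
Qed.

Lemma parallel_classes_partition M :
  partition (parallel_classes M) (nonloops M).
Proof.
apply: equivalence_partitionP => x y z xN yN zN; split; first by rewrite eqxx.
rewrite !nonloop_parallelE //.
have sym a b : indep M [set a; b] = indep M [set b; a] by rewrite setUC.
have tr a b c : b \in nonloops M -> a != c ->
    ~~ indep M [set a; b] -> ~~ indep M [set b; c] -> ~~ indep M [set a; c].
  rewrite nonloopE => indb ac nab nbc; apply/negP => indac.
  have lt : #|[set b]| < #|[set a; c]| by rewrite cards1 cards2 ac.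
  have [w] := indep_augment indb indac lt.
  rewrite !inE => /andP[_ /orP[]] /eqP ->; first by rewrite (negPf nab).
  by rewrite setUC (negPf nbc).
case: (eqVneq x y) => [->|xy] //= nxy.
case: (eqVneq x z) => [xz|xz]; case: (eqVneq y z) => [yz|yz] //=.
- by rewrite sym -xz nxy.
- by rewrite -yz nxy.
apply/idP/idP => [|nyz]; last exact: tr nxy nyz.
by rewrite sym in nxy; apply: tr nxy.
Qed.

(* A choice of simplification is a set R with exactly one element in each
   parallel class of nonloops; the simplification is then M restricted to R. *)
Definition simplification_choice M (R : {set T}) :=
  is_transversal R (parallel_classes M) (nonloops M).

Definition simplification M (R : {set T}) : matroid T := restriction M R.

(* The default value x of transversal_repr is never used when x is a nonloop
   and R is a choice of simplification. *)
Definition simple_repr M (R : {set T}) x :=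
  transversal_repr x R (pblock (parallel_classes M) x).

(* Loops have no image in the simplification. *)
Definition simple_image M (R : {set T}) S : {set T} :=
  [set simple_repr M R x | x in S :&: nonloops M].

End MatroidDefs.

(* Main.v *)
Require Import Defs.
From mathcomp Require Import all_boot.

(** Call a set of elements coindependent when some basis avoids it; such a set
has at most [corank M] elements.

A greedy procedure drives the proof.  Given a coindependent set F and indices
S whose cycles avoid F, an element f of the unique union of the cycles in S
lies in exactly one of them, say C_i; since C_i is a cycle avoiding F, the set
F + f is again coindependent, and the cycles indexed by S - i avoid it.  This
step keeps |F| + |S| constant, and it can be repeated until the unique union
of the remaining cycles lies inside any prescribed set X
([greedy_removal]).  When |F| + |S| is the corank, every cycle D of M avoiding
F lies in the union of the cycles in S, for otherwise an element of D outside
this union could be added to F, and running the procedure to the end would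
give a coindependent set larger than the corank ([cycle_cover]).

Without simplification the result now follows for every nonempty cycle D that
avoids the e_j ([dependent_unique_union]).  Starting from F = {e_1, ..., e_k}
and the indices outside [k], the procedure gives a set S for which the unique
union C_S is inside D, while the cycles in S cover D.  These two facts force
the unique union of the cycles indexed by [k] and S, which is dependent, to lie
inside the unique union of C_1, ..., C_k, D.

For the simplification, D is not used itself: it is replaced by a cycle of M,
called [lift] below, chosen class by class so that the unique union X of
C_1, ..., C_k and the lift meets each parallel class at most once, and only in
classes whose representative lies in the unique union of the simplified sets.
A class touched by C_1, ..., C_k in at least two elements, or touched by them
and met by D, contributes to the lift exactly its touched elements, which
removes the whole class from X; a class met by D and not touched contributes
its representative.  The lift is a cycle because two parallel elements form a
circuit and because replacing the elements of a circuit of size > 2 by parallel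
ones gives a circuit.  It avoids the e_j because their classes are singletons.
So X is dependent by the first part, and [lift_dependent] carries its
dependence over to the simplification. *)

Set Implicit Arguments.
Unset Strict Implicit.
Unset Printing Implicit Defensive.

(** * Unique unions *)

Section UniqueUnion.
Variables (T I : finType).
Implicit Types (A : I -> {set T}) (S : {set I}).

Lemma unique_unionP A S x :
  reflect (exists i, [/\ i \in S, x \in A i &
                       forall j, j \in S -> x \in A j -> j = i])
          (x \in unique_union A S).
Proof.
rewrite inE; apply: (iffP cards1P) => [[i eqi]|[i [iS xi unq]]]; exists i.
  have := set11 i; rewrite -eqi inE => /andP[iS xi]; split=> // j jS xj.
  by apply/set1P; rewrite -eqi inE jS.
apply/setP=> j; rewrite !inE; apply/andP/eqP => [[]|->] //; exact: unq.
Qed.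

End UniqueUnion.

(** * Independent sets and bases *)

Section Independence.
Variables (T : finType) (M : matroid T).
Implicit Types (A B D F I K X : {set T}).

Lemma indep_rank I : indep M I -> #|I| <= rank M.
Proof. by move=> indI; rewrite /rank (bigD1 I) //= leq_maxl. Qed.

Lemma exists_basis : exists2 B, indep M B & #|B| = rank M.
Proof.
have [|B indB eqB] := @eq_bigmax_cond {set T} (indep M) (fun I => #|I|).
  by apply/card_gt0P; exists set0; apply: indep_set0.
by exists B.
Qed.

Lemma indep_extend I B : indep M I -> indep M B -> #|I| <= #|B| ->
  exists J, [/\ indep M J, I \subset J, J \subset I :|: B & #|J| = #|B|].
Proof.
move=> + indB; have [n] := ubnP (#|B| - #|I|).
elim: n I => // n IHn I leBI indI leIB.
have [eqIB|ltIB] := eqVneq #|I| #|B|.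
  by exists I; split=> //; rewrite subsetUl.
have {leIB}ltIB : #|I| < #|B| by rewrite ltn_neqAle ltIB.
have [x /setDP[xB xI] indx] := indep_augment indI indB ltIB.
have [||J [indJ sIJ sJ cJ]] := IHn (x |: I) _ indx.
- by rewrite cardsU1 xI add1n subnS; move: leBI; rewrite -subn_gt0 in ltIB;
     case: (_ - _) ltIB.
- by rewrite cardsU1 xI.
exists J; split=> //; first exact: subset_trans (subsetUr _ _) sIJ.
apply: subset_trans sJ _; rewrite -setUA subUset subxx andbT sub1set.
by rewrite inE xB orbT.
Qed.

(** The element x lies in the closure of D - x: an independent I as below cannot
contain x.  A subset of the ground set is a cycle exactly when it spans each of
its elements in this sense, and this form survives changes of representatives
more easily than the existence of circuits. *)
Definition spanned D x :=
  exists I, [/\ indep M I, I \subset D & ~~ indep M (x |: I)].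

Lemma cycle_spanned D x : Defs.cycle M D -> x \in D -> spanned D x.
Proof.
case/existsP=> P /andP[/forall_inP circP /eqP->] /bigcupP[K KP xK].
have /minsetP[/andP[KE ndK] minK] := circP K KP.
exists (K :\ x); split; last by rewrite setD1K.
  apply: contraLR (xK) => ndKx.
  rewrite -(minK (K :\ x)) ?subD1set //; first by rewrite !inE eqxx.
  by rewrite /dependent ndKx (subset_trans (subD1set _ _)).
exact: subset_trans (subD1set _ _) (bigcup_sup K KP).
Qed.

Lemma cycle_ground D : Defs.cycle M D -> D \subset ground M.
Proof.
case/existsP=> P /andP[/forall_inP circP /eqP->]; apply/bigcupsP=> K KP.
by have /minsetp/andP[] := circP K KP.
Qed.

(** * Coindependent sets and greedy removal *)

(** Independence in the dual matroid, expressed through the bases of M. *)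
Definition coindep F :=
  F \subset ground M /\
  exists B, [/\ indep M B, #|B| = rank M & [disjoint B & F]].

Lemma coindep0 : coindep set0.
Proof.
split; first exact: sub0set.
by have [B] := exists_basis; exists B; split=> //; rewrite -setI_eq0 setI0.
Qed.

Lemma coindep_corank F : coindep F -> #|F| <= corank M.
Proof.
case=> FE [B [indB cB]]; rewrite -setI_eq0 => /eqP BF0.
rewrite /corank -cB leq_subRL ?subset_leq_card ?indep_ground //.
rewrite -[#|B| + _]subn0 -(cards0 T) -BF0 -cardsU subset_leq_card //.
by rewrite subUset FE indep_ground.
Qed.

(** As x is spanned by elements outside F, it is not a coloop of M deleted by F:
an independent set that spans x extends, inside its union with a basis avoiding
F, to a basis, and that basis cannot contain x. *)
Lemma coindepU1 F D x : coindep F -> x \in ground M -> spanned D x ->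
  [disjoint D & F] -> coindep (x |: F).
Proof.
case=> FE [B [indB cB BF]] xE [I [indI ID ndxI]] DF.
split; first by rewrite subUset sub1set xE.
have [|J [indJ sIJ sJ cJ]] := indep_extend indI indB.
  by rewrite cB indep_rank.
exists J; split=> //; first by rewrite cJ.
have xJ : x \notin J.
  apply: contra ndxI => xJ; apply: indep_subset indJ.
  by rewrite subUset sub1set xJ.
apply/pred0P=> y /=; rewrite !inE; apply/negP=> /andP[yJ /predU1P[yx|yF]].
  by rewrite -yx yJ in xJ.
have /setUP[yI|yB] := subsetP sJ y yJ.
  by rewrite (disjointFr DF (subsetP ID y yI)) in yF.
by rewrite (disjointFr BF yB) in yF.
Qed.

(** An element of the unique union outside X lies in a single C_i with i in S,
so it can be moved to F at the cost of the index i only; the cycle C_i shows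
that F stays coindependent.  The invariant |F| + |S| is what the corank is
compared with later. *)
Lemma greedy_removal (J : finType) (C : J -> {set T}) F (S : {set J}) X :
    (forall i, Defs.cycle M (C i)) -> coindep F ->
    (forall i, i \in S -> [disjoint C i & F]) ->
  exists F' (S' : {set J}),
    [/\ coindep F', F \subset F', S' \subset S & #|F'| + #|S'| = #|F| + #|S|] /\
    [/\ forall i, i \in S' -> [disjoint C i & F'], unique_union C S' \subset X
      & [disjoint F' :\: F & X]].
Proof.
move=> cycC; have [n] := ubnP #|S|; elim: n F S => // n IHn F S leSn coF CF.
have [sX|] := boolP (unique_union C S \subset X).
  exists F, S; split; split=> //.
  by rewrite setDv -setI_eq0 set0I.
case/subsetPn=> f /unique_unionP[i [iS fi unq]] fX.
have fF : f \notin F by rewrite (disjointFr (CF i iS) fi).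
have cS : #|S| = #|S :\ i|.+1 by rewrite (cardsD1 i S) iS.
have [|||F' [S' [[coF' sF sS cFS] [CF' sX dX]]]] := IHn (f |: F) (S :\ i).
- by rewrite cS in leSn.
- apply: coindepU1 (CF i iS) => //; last exact: cycle_spanned.
  exact: subsetP (cycle_ground (cycC i)) f fi.
- move=> j /setD1P[ji jS]; apply/pred0P=> y /=; rewrite !inE.
  apply/negP=> /andP[yj /predU1P[yf|yF]].
    by rewrite yf in yj; rewrite (unq j jS yj) eqxx in ji.
  by rewrite (disjointFr (CF j jS) yj) in yF.
exists F', S'; split; split=> //.
- exact: subset_trans (subsetUr _ _) sF.
- exact: subset_trans sS (subD1set _ _).
- by rewrite cFS cardsU1 fF cS addSnnS.
apply/pred0P=> y /=; apply/negP=> /andP[/setDP[yF' yF] yX].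
case: (eqVneq y f) fX => [<-|yf _]; first by rewrite yX.
have /(disjointFr dX) : y \in F' :\: (f |: F) by rewrite !inE negb_or yf yF.
by rewrite yX.
Qed.

(** If x were in no C_i with i in S, it could join F without costing an index.
Greedy removal with target set0 then uses up all of S, as the unique union of a
nonempty subfamily is dependent and hence nonempty, and ends with more than
corank M coindependent elements. *)
Lemma cycle_cover (J : finType) (C : J -> {set T}) F (S : {set J}) D x :
    (forall i, Defs.cycle M (C i)) ->
    (forall S' : {set J}, S' != set0 -> dependent M (unique_union C S')) ->
    coindep F -> (forall i, i \in S -> [disjoint C i & F]) ->
    corank M <= #|F| + #|S| ->
    [disjoint D & F] -> x \in ground M -> x \in D -> spanned D x ->
  exists2 i, i \in S & x \in C i.
Proof.
move=> cycC depC coF CF leg DF xE xD spx.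
apply/exists_inP; apply: contraT => /exists_inPn nx.
have coFx := coindepU1 coF xE spx DF.
have [|F' [S' [[coF' _ _ cFS] [_ sX _]]]] :=
  @greedy_removal J C _ S set0 cycC coFx.
  move=> i iS; apply/pred0P=> y /=; rewrite !inE.
  apply/negP=> /andP[yi /predU1P[yx|yF]].
    by move: (nx i iS); rewrite -yx yi.
  by rewrite (disjointFr (CF i iS) yi) in yF.
have S'0 : S' = set0.
  apply/eqP; apply: contraT => /depC /andP[_].
  move: sX; rewrite subset0 => /eqP->.
  by rewrite indep_set0.
have := coindep_corank coF'; rewrite -[#|F'|]addn0 -(cards0 J) -S'0 cFS.
by rewrite cardsU1 (disjointFr DF xD) add1n addSn ltnNge leg.
Qed.

(** The result before simplification.  Greedy removal starts from the e_j and
the indices outside the range of w, with target D; it leaves a set S of indices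
whose cycles cover D and have their unique union inside D.  An element in
exactly one cycle indexed by S or by the range of w is then in D and in no
C (w j), or is outside D and in exactly one C (w j). *)
Lemma dependent_unique_union (I J : finType) (C : I -> {set T})
    (w : J -> I) (e : J -> T) D :
    (forall i, Defs.cycle M (C i)) ->
    (forall S : {set I}, S != set0 -> dependent M (unique_union C S)) ->
    corank M <= #|I| -> injective w ->
    (forall j i, (e j \in C i) = (i == w j)) ->
    D \subset ground M -> D != set0 ->
    (forall j, e j \notin D) -> (forall x, x \in D -> spanned D x) ->
  dependent M (unique_union (fun o => if o is Some j then C (w j) else D)
                            [set: option J]).
Proof.
move=> cycC depC leg injw eC DE Dn0 eD spD.
have eE j : e j \in ground M.
  by apply: (subsetP (cycle_ground (cycC (w j)))); rewrite eC.
have inje : injective e.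
  by move=> j j' eqe; apply/injw/eqP; rewrite -eC -eqe eC.
(* Each C (w j) contains no other e_j', so the e_j can be added in any order. *)
have coA (A : {set J}) : coindep (e @: A).
  have [n] := ubnP #|A|; elim: n A => // n IHn A leAn.
  have [->|[j jA]] := set_0Vmem A; first by rewrite imset0; apply: coindep0.
  rewrite -(setD1K jA) imsetU1; apply: (@coindepU1 _ (C (w j))) => //.
  - by apply: IHn; rewrite (cardsD1 j) jA in leAn.
  - by apply: cycle_spanned; rewrite ?eC.
  apply/pred0P=> x /=; apply/negP=> /andP[+ /imsetP[j' /setD1P[nj _] xe]].
  by rewrite xe eC => /eqP /injw jj; rewrite jj eqxx in nj.
have CF i : i \in ~: (w @: setT) -> [disjoint C i & e @: setT].
  move=> iw; apply/pred0P=> x /=; apply/negP=> /andP[xi /imsetP[j _ xe]].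
  by move: iw; rewrite xe eC in xi; rewrite inE (eqP xi) imset_f.
have [F [S [[coF sF sS cFS] [CF' CSD dD]]]] :=
  greedy_removal D cycC (coA setT) CF.
(* The e_j avoid D and the elements removed later do too, so D avoids F. *)
have DF : [disjoint D & F].
  apply/pred0P=> x /=; apply/negP=> /andP[xD xF].
  have [/imsetP[j _ xe]|xe] := boolP (x \in e @: setT).
    by move: (eD j); rewrite -xe xD.
  have /(disjointFr dD) : x \in F :\: e @: setT by rewrite inE xe.
  by rewrite xD.
have cover x : x \in D -> exists2 i, i \in S & x \in C i.
  move=> xD; apply: (cycle_cover cycC depC coF CF' _ DF) => //; last exact: spD.
    by rewrite cFS card_imset // -(card_imset setT injw) cardsC.
  exact: subsetP DE x xD.
have /set0Pn[x0 x0D] := Dn0; have [i0 i0S _] := cover x0 x0D.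
have [|_ nd] := andP (depC (w @: setT :|: S) _).
  by apply/set0Pn; exists i0; rewrite inE i0S orbT.
apply/andP; split.
  apply/subsetP=> x /unique_unionP[[j|] [_ xj _]]; last exact: subsetP DE x xj.
  exact: subsetP (cycle_ground (cycC (w j))) x xj.
apply: contra nd; apply: indep_subset; apply/subsetP=> x.
case/unique_unionP=> i [iT xi unq]; apply/unique_unionP.
have [xD|xD] := boolP (x \in D).
  have [s sS' xs] := cover x xD; exists None; split=> // [[j|//] _ xj].
  have eqs : s = w j.
    have -> : s = i by apply: unq; rewrite // inE sS' orbT.
    by apply/esym/unq; rewrite // inE imset_f.
  by have := subsetP sS s sS'; rewrite eqs inE imset_f.
have [iS|iS] := boolP (i \in S).
  case/negP: xD; apply: (subsetP CSD); apply/unique_unionP; exists i.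
  split=> //.
  by move=> j jS; apply: unq; rewrite inE jS orbT.
move: iT; rewrite inE (negPf iS) orbF => /imsetP[j _ ij]; exists (Some j).
split=> //; first by rewrite -ij.
move=> [j' _ xj'|_]; last by rewrite (negPf xD).
by congr Some; apply: injw; rewrite -ij; apply: unq; rewrite // inE imset_f.
Qed.

(** * Exchanging parallel elements *)

Definition coincident x y := (x == y) || ~~ indep M [set x; y].

Lemma coincident_indep A x y :
  indep M A -> x \in A -> y \in A -> coincident x y -> x = y.
Proof.
move=> indA xA yA /predU1P[//|/negP[]]; apply: indep_subset indA.
by rewrite subUset !sub1set xA.
Qed.

(** Extending [set w] inside w |: A to the size of A omits a single element of
w |: A, which can only be z. *)
Lemma indep_swap A z w : indep M A -> z \in A -> indep M [set w] ->
  coincident z w -> indep M (w |: A :\ z).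
Proof.
move=> indA zA indw czw; have [<-|zw] := eqVneq z w; first by rewrite setD1K.
have wA : w \notin A.
  by apply/negP=> wA; rewrite (coincident_indep indA zA wA czw) eqxx in zw.
have [|J [indJ sJ]] := indep_extend indw indA.
  by rewrite cards1 (cardsD1 z) zA.
rewrite sub1set in sJ => sJA cJ.
have zJ : z \notin J.
  by apply/negP=> zJ; rewrite (coincident_indep indJ zJ sJ czw) eqxx in zw.
suff <- : J = w |: A :\ z by [].
apply/eqP; rewrite eqEcard cJ cardsU1 !inE (negPf wA) andbF.
rewrite (cardsD1 z A) zA leqnn andbT; apply/subsetP=> y yJ.
have := subsetP sJA y yJ; rewrite !inE.
case/predU1P=> [->|->]; first by rewrite eqxx.
by rewrite andbT orbC; case: eqVneq yJ zJ => [->->|].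
Qed.

(** A maximal independent subset of the image that were smaller than A could be
augmented by some x in A, and then by s x instead of x.  Hence it has at least
#|A| elements and is the whole image. *)
Lemma indep_imset A (s : T -> T) : indep M A ->
    (forall z, z \in A -> indep M [set s z] /\ coincident z (s z)) ->
  indep M (s @: A).
Proof.
move=> indA sP.
pose P I := indep M I && (I \subset s @: A).
have P0 : P set0 by rewrite /P indep_set0 sub0set.
have [I /andP[indI sI] maxI] := arg_maxnP (fun I : {set T} => #|I|) P0.
have [leAI|ltIA] := leqP #|A| #|I|.
  suff <- : I = s @: A by [].
  by apply/eqP; rewrite eqEcard sI (leq_trans (leq_imset_card _ _)).
have [x /setDP[xA xI] indx] := indep_augment indI indA ltIA.
have [indsx csx] := sP x xA; have [sxI|sxI] := boolP (s x \in I).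
  case/negP: (xI); rewrite (coincident_indep indx _ _ csx) ?setU11 //.
  by rewrite inE sxI orbT.
have := indep_swap indx (setU11 x I) indsx csx; rewrite setU1K // => indsxI.
have := maxI (s x |: I); rewrite /P indsxI subUset sub1set sI imset_f //=.
by rewrite cardsU1 sxI ltnn => /(_ isT).
Qed.
End Independence.

(** * Representatives of the parallel classes *)

Section Simplification.
Variables (T : finType) (M : matroid T) (R : {set T}).
Hypothesis loopless : forall x, x \in ground M -> indep M [set x].
Hypothesis simpR : simplification_choice M R.
Implicit Types (D K X Y : {set T}) (x y z : T).

Local Notation E := (ground M).
Local Notation rho := (simple_repr M R).

Lemma loopless_nonloops : nonloops M = E.
Proof.
apply/setP=> x; rewrite nonloopE; apply/idP/idP; last exact: loopless.
by move/indep_ground; rewrite sub1set.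
Qed.

(** The blocks are read off the definition of the classes, so that the
transitivity of parallelism is only used through
[parallel_classes_partition]. *)
Lemma mem_pblock_coincident x y : x \in E -> y \in E ->
  (y \in pblock (parallel_classes M) x) = coincident M x y.
Proof.
rewrite -loopless_nonloops => xE yE.
have /and3P[_ tiP _] := parallel_classes_partition M.
rewrite (@def_pblock _ _ [set z in nonloops M | (x == z) || parallel M x z]) //.
- by rewrite inE yE nonloop_parallelE.
- by apply/imsetP; exists x.
- by rewrite inE xE eqxx.
Qed.

Lemma pblock_class x : x \in E ->
  pblock (parallel_classes M) x \in parallel_classes M.
Proof.
rewrite -loopless_nonloops => xE; apply: pblock_mem.
by have /and3P[/eqP-> _ _] := parallel_classes_partition M.
Qed.

Lemma simple_repr_in x : x \in E -> rho x \in R.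
Proof.
move=> xE; apply: (repr_mem_transversal simpR); exact: pblock_class.
Qed.

Lemma simplification_choice_ground : R \subset E.
Proof. by rewrite -loopless_nonloops; case/and3P: simpR. Qed.

Lemma simple_repr_ground x : x \in E -> rho x \in E.
Proof.
by move/simple_repr_in; apply: subsetP simplification_choice_ground _.
Qed.

Lemma simple_repr_coincident x : x \in E -> coincident M x (rho x).
Proof.
move=> xE; rewrite -mem_pblock_coincident ?simple_repr_ground //.
by apply: (repr_mem_pblock simpR); apply: pblock_class.
Qed.

Lemma simple_repr_id x : x \in R -> rho x = x.
Proof. by move=> xR; apply: (pblockK simpR). Qed.

Lemma simple_repr_eq x y : x \in E -> y \in E ->
  (rho x == rho y) = coincident M x y.
Proof.
move=> xE yE; have /and3P[_ tiP _] := parallel_classes_partition M.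
have blk z : z \in E ->
    pblock (parallel_classes M) z = pblock (parallel_classes M) (rho z).
  by move=> zE; apply/esym/same_pblock => //;
     rewrite mem_pblock_coincident ?simple_repr_ground ?simple_repr_coincident.
rewrite -mem_pblock_coincident //; apply/eqP/idP=> [eqr|yx].
  rewrite blk // eqr -blk // mem_pblock.
  by have /and3P[/eqP-> _ _] := parallel_classes_partition M;
     rewrite loopless_nonloops.
rewrite /simple_repr -(same_pblock tiP yx).
have zRy : rho y \in R :&: pblock (parallel_classes M) y.
  rewrite inE simple_repr_in //=.
  by rewrite mem_pblock_coincident ?simple_repr_ground ?simple_repr_coincident.
by rewrite /transversal_repr; case: pickP => // /(_ (rho y)); rewrite zRy.
Qed.

Lemma mem_simple_image X r : X \subset E ->
  reflect (exists2 x, x \in X & rho x = r) (r \in simple_image M R X).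
Proof.
move=> XE; rewrite /simple_image loopless_nonloops (setIidPl XE).
by apply: (iffP imsetP) => [[x xX ->]|[x xX <-]]; exists x.
Qed.

Lemma simple_image_R X : simple_image M R X \subset R.
Proof.
apply/subsetP=> _ /imsetP[x /setIP[_ xE] ->].
by apply: simple_repr_in; rewrite -loopless_nonloops.
Qed.

(** Independence of a set without parallel pairs depends only on the parallel
classes that it meets: replacing the elements of Y by the parallel elements of
X keeps it independent, and covers X.  Both the passage to the simplification
and the change of representatives in a circuit rest on this. *)
Lemma indep_of_simple_repr X Y : X \subset E -> Y \subset E ->
    {in X &, injective rho} -> (forall x, x \in X -> rho x \in rho @: Y) ->
  indep M Y -> indep M X.
Proof.
move=> XE YE injX XY indY.
pose s y := odflt y [pick x in X | rho x == rho y].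
have sP y : y \in Y -> s y \in E /\ rho (s y) = rho y.
  move=> yY; rewrite /s; case: pickP => [x /andP[xX /eqP]|_] /=.
    by split=> //; apply: subsetP XE x xX.
  by split=> //; apply: subsetP YE y yY.
have: indep M (s @: Y).
  apply: indep_imset => // y yY; have [sE sr] := sP y yY.
  have yE := subsetP YE y yY; split; first exact: loopless.
  by rewrite -simple_repr_eq ?sr.
apply: indep_subset; apply/subsetP=> x xX.
have /imsetP[y yY xy] := XY x xX; apply/imsetP; exists y => //.
rewrite /s; case: pickP => [x' /andP[xX' /eqP rx]|/(_ x)] /=.
  by apply: injX; rewrite ?rx.
by rewrite xX xy eqxx.
Qed.

(** * Lifting cycles from the simplification *)

Section Lift.
Variables (J : finType) (C : J -> {set T}) (D : {set T}).
Hypotheses (CE : forall j, C j \subset E) (DE : D \subset E).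

Definition touched x := x \in cover [set C j | j : J].

(** In a class touched by some C j, the untouched elements stay out.  The
touched ones enter when D meets the class, or when there are at least two of
them, so that they are mutually parallel; a lone touched element of a class
missing D stays out, and then accounts for the class in the unique union.  A
class met by D but not touched enters through its representative. *)
Definition lift : {set T} := [set x in E |
  if touched x then
    (rho x \in simple_image M R D)
      || [exists y, [&& y != x, rho y == rho x & touched y]]
  else (x \in simple_image M R D)
      && ~~ [exists y, (rho y == x) && touched y]].

Lemma touchedP x : reflect (exists j, x \in C j) (touched x).
Proof.
rewrite /touched cover_imset; apply: (iffP bigcupP) => [[j _ xj]|[j xj]];
by exists j.
Qed.

Lemma touched_ground x : touched x -> x \in E.
Proof. by case/touchedP=> j; apply: (subsetP (CE j)). Qed.

Lemma lift_meets z : z \in D -> exists2 w, w \in lift & rho w = rho z.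
Proof.
move=> zD; have zE := subsetP DE z zD.
have rzD : rho z \in simple_image M R D.
  by apply/mem_simple_image => //; exists z.
have rrz : rho (rho z) = rho z by apply/simple_repr_id/simple_repr_in.
have [/existsP[w /andP[/eqP rw tw]]|nt] :=
    boolP [exists y, (rho y == rho z) && touched y].
  by exists w; rewrite // inE tw touched_ground // rw rzD.
exists (rho z) => //; rewrite inE simple_repr_ground // rzD nt.
case: ifP => // trz; case/negP: nt; apply/existsP; exists (rho z).
by rewrite rrz eqxx.
Qed.

(** Either x has a second touched element in its class, which is parallel to it,
or D meets its class; then some circuit K in D meets it too, and exchanging
each element of K for a parallel element of the lift, with x for its own class,
keeps K - y independent and K dependent. *)
Lemma lift_spanned x :
    (forall z, z \in D -> exists K, [/\ z \in K, K \subset D, ~~ indep M K,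
       indep M (K :\ z) & {in K &, injective rho}]) ->
  x \in lift -> spanned M lift x.
Proof.
move=> circD xL; have xE : x \in E by move: xL; rewrite inE => /andP[].
have pair y : y \in lift -> y != x -> rho y = rho x -> spanned M lift x.
  move=> yL yx rxy; have yE : y \in E by move: yL; rewrite inE => /andP[].
  exists [set y]; split; [exact: loopless | by rewrite sub1set |].
  have : coincident M x y by rewrite -simple_repr_eq ?rxy.
  by rewrite /coincident eq_sym (negPf yx).
have from_image : rho x \in simple_image M R D -> spanned M lift x.
  case/(mem_simple_image _ DE)=> y yD ryx.
  have [K [yK KD ndK indK injK]] := circD y yD.
  have KE := subset_trans KD DE.
  pose s z := if rho z == rho x then x
              else odflt z [pick w in lift | rho w == rho z].
  have sP z : z \in K -> s z \in lift /\ rho (s z) = rho z.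
    move=> zK; rewrite /s; case: eqP => // _; case: pickP => [w|no] /=.
      by case/andP=> wL /eqP.
    have [w wL rw] := lift_meets (subsetP KD z zK).
    by move: (no w); rewrite wL rw eqxx.
  have LE : lift \subset E by apply/subsetP=> z; rewrite inE => /andP[].
  have sL : s @: (K :\ y) \subset lift.
    by apply/subsetP=> _ /imsetP[z /setD1P[_ /sP[sz _]] ->].
  exists (s @: (K :\ y)); split=> //.
    apply: indep_imset => // z /setD1P[_ zK]; have [szL rsz] := sP z zK.
    have szE := subsetP LE _ szL; have zE := subsetP KE z zK.
    by split; [exact: loopless | rewrite -simple_repr_eq ?rsz].
  apply: contra ndK; apply: indep_of_simple_repr => //.
    by rewrite subUset sub1set xE (subset_trans sL).
  move=> z zK; have [zy|zy] := eqVneq z y.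
    by rewrite zy ryx imset_f // setU11.
  have [_ <-] := sP z zK; rewrite imset_f // inE imset_f ?orbT //.
  by rewrite !inE zy.
have : x \in lift := xL; rewrite inE xE /=.
have [tx|tx] := boolP (touched x).
  case/orP; last first.
    case/existsP=> y /and3P[yx /eqP rxy ty]; apply: (pair y) => //.
    rewrite inE touched_ground // ty; apply/orP; right.
    by apply/existsP; exists x; rewrite eq_sym yx rxy eqxx.
  exact: from_image.
case/andP=> xD _; apply: from_image; rewrite simple_repr_id //.
exact: subsetP (simple_image_R D) x xD.
Qed.

Lemma lift_disjoint x : touched x -> x \notin D ->
  (forall y, y \in E -> rho y = rho x -> y = x) -> x \notin lift.
Proof.
move=> tx xD single; rewrite inE tx negb_and negb_or; apply/orP; right.
apply/andP; split.
  apply: contra xD => /(mem_simple_image _ DE)[y yD ry].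
  by rewrite -(single y) // (subsetP DE).
apply/existsP=> -[y /and3P[yx /eqP ry ty]].
by rewrite (single y) ?eqxx // touched_ground in yx.
Qed.

(** The unique union X of the C j and the lift has at most one element in each
parallel class, and its classes are represented in the unique union of the
simplified sets; so X would be independent if the latter were. *)
Lemma lift_dependent :
    dependent M (unique_union (fun o => if o is Some j then C j else lift)
                              [set: option J]) ->
  dependent (simplification M R)
    (unique_union (fun o => if o is Some j then simple_image M R (C j)
                            else simple_image M R D) [set: option J]).
Proof.
set X := unique_union _ _; set Y := unique_union _ _ => /andP[XE ndX].
have YR : Y \subset R.
  apply/subsetP=> y /unique_unionP[[j|] [_ + _]];
  exact: subsetP (simple_image_R _) y.
have YE := subset_trans YR simplification_choice_ground.
apply/andP; split; first by rewrite subsetI YE.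
rewrite negb_and; apply/orP; left; apply: contra ndX.
(* The two ways to belong to X: through the lift alone, or through a single C j.
   In both cases the rest of the class of x is outside X. *)
have XP x : x \in X ->
    [/\ ~~ touched x, x \in simple_image M R D &
        forall y, touched y -> rho y <> x] \/
    (exists j, [/\ x \in C j, rho x \notin simple_image M R D &
        forall y i, y \in C i -> rho y = rho x -> y = x /\ i = j]).
  move=> xX; have xE := subsetP XE x xX.
  have [tx|tx] := boolP (touched x); [right|left];
    case/unique_unionP: xX => -[j|] [_ xo unq].
  - exists j; have : x \notin lift.
      by apply/negP=> xL; have := unq None (in_setT _) xL.
    rewrite inE xE tx /= negb_or => /andP[-> /existsPn none].
    split=> // y i yi ry.
    suff yx : y = x.
      by split=> //; rewrite yx in yi; case: (unq (Some i) (in_setT _) yi).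
    apply: contraNeq (none y) => ->; rewrite ry eqxx /=.
    by apply/touchedP; exists i.
  - by have /touchedP[j xj] := tx; have := unq (Some j) (in_setT _) xj.
  - by case/touchedP: tx; exists j.
  move: xo; rewrite inE xE (negPf tx) /= => /andP[-> /existsPn none].
  by split=> // y ty ry; move: (none y); rewrite ry eqxx ty.
have mem_touched x j : x \in C j -> touched x.
  by move=> xj; apply/touchedP; exists j.
have fixed x : x \in simple_image M R D -> rho x = x.
  by move/(subsetP (simple_image_R D)); apply: simple_repr_id.
apply: indep_of_simple_repr => //.
  move=> x y /XP[[_ xD nx]|[j [xj _ unqx]]] /XP[[_ yD ny]|[i [yi _ unqy]]] rxy.
  - by rewrite -(fixed x xD) rxy fixed.
  - by case: (nx y (mem_touched y i yi)); rewrite -rxy fixed.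
  - by case: (ny x (mem_touched x j xj)); rewrite rxy fixed.
  by have [] := unqy x j xj rxy.
move=> x xX; have xE := subsetP XE x xX.
have CP j y : y \in simple_image M R (C j) -> exists2 z, z \in C j & rho z = y.
  by move/(mem_simple_image _ (CE j)).
case: (XP x xX) => [[tx xD nx]|[j [xj xD unq]]].
  apply: imset_f; apply/unique_unionP; exists None; split=> // -[i|//] _.
  by case/CP=> z /mem_touched /nx.
rewrite -[rho x]simple_repr_id ?simple_repr_in // imset_f //.
apply/unique_unionP; exists (Some j); split=> //.
  by apply/mem_simple_image => //; exists x.
move=> [i|] _; last by rewrite (negPf xD).
by case/CP=> z zi /(unq z i zi)[_ ->].
Qed.

End Lift.

End Simplification.

(** * The theorem *)

Lemma connected_loopless (T : finType) (M : matroid T) x y :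
  connected M -> x \in ground M -> y \in ground M -> x != y ->
  indep M [set x].
Proof.
move=> conM xE yE xy; have [A circA /andP[xA yA]] := conM x y xE yE xy.
apply: contraT => ndx; have /minsetP[_ minA] := circA.
have xAe : [set x] = A by apply: minA; rewrite /dependent ?sub1set ?xE.
by move: yA; rewrite -xAe inE eq_sym (negPf xy).
Qed.

Theorem theorem3p8 (T : finType) (M : matroid T)
    (C : 'I_(corank M) -> {set T}) (k : nat) (hk : k <= corank M)
    (e : 'I_k -> T) (n : nat) (D : 'I_n -> {set T}) (R : {set T}) :
  connected M ->
  cycle_system C ->
  (forall i : 'I_k, e i \in unique_union C [set: 'I_(corank M)]) ->
  (forall i : 'I_k, e i \in C (widen_ord hk i)) ->
  (forall (i : 'I_k) (x : T), ~~ parallel M (e i) x) ->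
  0 < n ->
  (forall j : 'I_n, circuit (deletion M [set e i | i : 'I_k]) (D j)) ->
  (forall j : 'I_n, 2 < #|D j|) ->
  simplification_choice M R ->
  dependent (simplification M R)
    (unique_union
       (fun o : option 'I_k =>
          if o is Some i then simple_image M R (C (widen_ord hk i))
          else simple_image M R (\bigcup_(j < n) D j))
       [set: option 'I_k]).
Proof.
move=> conM [cycC depC] eU eC nparE n_gt0 circD szD simpR.
have DjE j : D j \subset ground M :\: [set e i | i : 'I_k].
  have /minsetp/andP[+ _] := circD j.
  by move/subset_trans; apply; rewrite subIset // subxx orbT.
have DjM j : D j \subset ground M := subset_trans (DjE j) (subsetDl _ _).
have ndD j : ~~ indep M (D j).
  have /minsetp/andP[_] := circD j.
  by rewrite /= /restrict_indep DjE andbT.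
have indD j (A : {set T}) : A \proper D j -> indep M A.
  move=> pA; have sA := proper_sub pA; apply: contraT => ndA.
  have /minsetP[_ minD] := circD j.
  have AD : A = D j.
    apply: minD => //; have AE := subset_trans sA (DjE j).
    rewrite /dependent /= /restrict_indep negb_and ndA andbT subsetI AE andbT.
    exact: subset_trans AE (subsetDl _ _).
  by rewrite AD properxx in pA.
pose j0 := Ordinal n_gt0.
have loopless x : x \in ground M -> indep M [set x].
  move=> xE; have /card_gt0P[y] : 0 < #|D j0 :\ x|.
    by have := szD j0; rewrite (cardsD1 x); case: (x \in _) => /=; case: #|_|.
  case/setD1P=> yx yD; apply: (connected_loopless (y := y) conM xE).
    exact: subsetP (DjM j0) y yD.
  by rewrite eq_sym.
have DE : \bigcup_(j < n) D j \subset ground M by apply/bigcupsP.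
pose Ck i := C (widen_ord hk i).
have CE i : Ck i \subset ground M by exact: cycle_ground (cycC _).
have eE i : e i \in ground M by exact: subsetP (CE i) _ (eC i).
(* A circuit with more than two elements contains no parallel pair. *)
have pairD j : {in D j &, injective (simple_repr M R)}.
  move=> x y xD yD /eqP; have DjMP := subsetP (DjM j).
  rewrite (simple_repr_eq loopless simpR) ?DjMP //.
  case/orP=> [/eqP //|/negP[]]; apply: (indD j); rewrite properEcard.
  rewrite subUset !sub1set xD yD (leq_trans _ (szD j)) // ltnS.
  by rewrite cards2; case: (_ != _).
apply: (lift_dependent loopless simpR CE).
apply: (dependent_unique_union (C := C) (w := widen_ord hk) (e := e)) => //.
- by rewrite card_ord.
- by move=> i i' /(congr1 val) /= eqi; apply: val_inj.
- move=> j i; have /unique_unionP[i0 [_ _ unq]] := eU j.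
  apply/idP/eqP => [ei|->]; last exact: eC.
  by rewrite [i]unq // [widen_ord hk j]unq.
- by apply/subsetP=> x; rewrite inE => /andP[].
- have /card_gt0P[z zD] : 0 < #|D j0| by apply: leq_trans (szD j0).
  have [|w wL _] := lift_meets loopless simpR CE DE (z := z).
    by apply/bigcupP; exists j0.
  by apply/set0Pn; exists w.
- move=> i; apply: lift_disjoint => //.
  + by apply/touchedP; exists i.
  + apply/bigcupP=> -[j _ /(subsetP (DjE j))/setDP[_]].
    by rewrite imset_f.
  move=> y yE /eqP; rewrite eq_sym (simple_repr_eq loopless simpR) //.
  rewrite /coincident -nonloop_parallelE ?(loopless_nonloops loopless) //.
  by rewrite (negPf (nparE i y)) orbF => /eqP.
move=> x; apply: (lift_spanned loopless simpR CE DE) => z /bigcupP[j _ zj].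
exists (D j); split=> //; first exact: bigcup_sup.
by apply: (indD j); rewrite properD1.
Qed.
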